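(* Let $K$ be a reduced commutative ring with $\frac12\in K$, let $n\ge2$, let $G=\mathrm{Aut}_K(\Lambda_n)$ and let $\mathrm{Stab}(x_1)=\{\sigma\in G\mid\sigma(x_1)=x_1\}$. Put $$\Omega_{x_1}:=\Omega\cap\mathrm{Stab}(x_1)=\{\omega_{1+a}\mid a\in(x_1)\cap\Lambda_n^{od}\},$$ $$\Gamma_{x_1}:=\Gamma\cap\mathrm{Stab}(x_1)=\{\gamma_b\mid b=(0,b_2,\ldots,b_n),\ b_i\in\Lambda_{n,\ge3}^{od}\},$$ $$\mathrm{GL}_n(K)^{op}_{x_1}:=\mathrm{GL}_n(K)^{op}\cap\mathrm{Stab}(x_1)=\{\sigma_A\mid\sigma_A(x_1)=x_1,\ A\in\mathrm{GL}_n(K)\}.$$ Then $$\mathrm{Stab}(x_1)=\Omega_{x_1}\Gamma_{x_1}\mathrm{GL}_n(K)^{op}_{x_1}=(\Omega_{x_1}\rtimes\Gamma_{x_1})\rtimes\mathrm{GL}_n(K)^{op}_{x_1}.$$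
   Context: $\Lambda_n=\Lambda_n(K)=K\lfloor x_1,\ldots,x_n\rfloor$ is the Grassmann algebra: the $K$-algebra with generators $x_1,\ldots,x_n$ and defining relations $x_i^2=0$, $x_ix_j=-x_jx_i$ ($i\ne j$). $\Lambda_{n,i}$ is the $K$-span of the products of $i$ distinct generators, $\Lambda_n^{od}=\bigoplus_{i\text{ odd}}\Lambda_{n,i}$, and $\mathfrak m=\bigoplus_{i\ge1}\Lambda_{n,i}$; $\Lambda_{n,\ge3}^{od}=\Lambda_n^{od}\cap\mathfrak m^3$; $(x_1)=x_1\Lambda_n=\Lambda_nx_1$. $\Lambda_n'^{od}=\bigoplus_i\Lambda_{n,i}$ over odd $i$ with $1\le i\le n-1$. $G=\mathrm{Aut}_K(\Lambda_n)$ is the group of $K$-algebra automorphisms of $\Lambda_n$. It contains the following subgroups. - $\Omega=\{\omega_{1+a}\mid a\in\Lambda_n'^{od}\}$, where for a unit $u$, $\omega_u(x)=uxu^{-1}$. - $\Gamma=\{\gamma_b\mid b=(b_1,\ldots,b_n),\ b_i\in\Lambda_n^{od}\cap\mathfrak m^3\}$, where $\gamma_b$ is the $K$-algebra automorphism with $\gamma_b(x_i)=x_i+b_i$ for all $i$. - $\mathrm{GL}_n(K)^{op}=\{\sigma_A\mid A=(a_{ij})\in\mathrm{GL}_n(K)\}$, where $\sigma_A(x_i)=\sum_{j=1}^n a_{ij}x_j$. Here $H\rtimes L$ denotes an internal semidirect product with normal factor $H$. *)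

(* Defs.v *)
From HB Require Import structures.
From mathcomp Require Import all_boot all_order all_algebra.
From mathcomp Require Import boolp.

Set Implicit Arguments.
Unset Strict Implicit.
Unset Printing Implicit Defensive.

Import GRing.Theory.

Local Open Scope ring_scope.

(* [comPzRingType] is used throughout, so the zero ring is allowed for K. The  *)
(* library's [algType] and [{lrmorphism _ -> _}] exclude it; for this reason   *)
(* Lambda_n is given its ring and its K-module structure separately, and       *)
(* K-algebra morphisms are unital ring morphisms that are K-linear.            *)

Definition reduced (K : comPzRingType) : Prop :=
  forall (a : K) (k : nat), a ^+ k = 0 -> a = 0.

Definition has_half (K : comPzRingType) : Prop :=
  exists h : K, h *+ 2 = 1.

(* The Grassmann algebra, in coordinates: f stands for the sum over S of       *)
(* f S *: x_S, where x_S = x_(s_1) ... x_(s_k) for S = {s_1 < ... < s_k}; see  *)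
(* grassmann_gen_prod and grassmann_basisE below.                              *)
Definition grassmann (K : comPzRingType) (n : nat) : Type :=
  {ffun {set 'I_n} -> K}.

Section Grassmann.
Variables (K : comPzRingType) (n : nat).
Local Notation L := (grassmann K n).
Implicit Types (A B C S : {set 'I_n}) (f g h : L).

HB.instance Definition _ := GRing.Lmodule.copy L {ffun {set 'I_n} -> K^o}.

(* Reordering x_A x_B into x_(A :|: B) costs one sign per inversion.           *)
Definition inversions A B : nat :=
  (\sum_(i in A) \sum_(j in B) (j < i))%N.

Definition gmul f g : L :=
  [ffun S : {set 'I_n} => \sum_(A : {set 'I_n} | A \subset S)
     (-1) ^+ inversions A (S :\: A) * f A * g (S :\: A)].

Definition gbasis S : L := [ffun T => (T == S)%:R].

Definition gone : L := gbasis set0.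

Lemma inversionsU A B C : [disjoint A & B] ->
  inversions (A :|: B) C = (inversions A C + inversions B C)%N.
Proof.
move=> dAB; rewrite /inversions -bigU //; apply: eq_bigl => i.
by rewrite !inE.
Qed.

Lemma inversionsUr A B C : [disjoint B & C] ->
  inversions A (B :|: C) = (inversions A B + inversions A C)%N.
Proof.
move=> dBC; rewrite /inversions -big_split /=; apply: eq_bigr => i _.
by rewrite -bigU //; apply: eq_bigl => j; rewrite !inE.
Qed.

Lemma inversions0l A : inversions set0 A = 0%N.
Proof. by rewrite /inversions big_set0. Qed.

Lemma inversions0r A : inversions A set0 = 0%N.
Proof. by rewrite /inversions big1 // => i _; rewrite big_set0. Qed.

Lemma gmul1f : left_id gone gmul.
Proof.
move=> f; apply/ffunP => S; rewrite ffunE (bigD1 set0) ?sub0set //=.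
rewrite ffunE eqxx setD0 inversions0l expr0 !mul1r big1 ?addr0 // => A /andP[_].
by move=> /negPf nA; rewrite ffunE nA mulr0 mul0r.
Qed.

Lemma gmulf1 : right_id gone gmul.
Proof.
move=> f; apply/ffunP => S; rewrite ffunE (bigD1 S) //=.
rewrite ffunE setDv eqxx inversions0r expr0 mul1r mulr1 big1 ?addr0 //.
move=> A /andP[sAS nA]; rewrite ffunE; case: eqP => [|_]; last by rewrite mulr0.
by move=> /eqP; rewrite setD_eq0 => sSA; rewrite eqEsubset sAS sSA in nA.
Qed.

Lemma gmulDl : left_distributive gmul +%R.
Proof.
move=> f g h; apply/ffunP => S; rewrite !ffunE -big_split /=.
by apply: eq_bigr => A _; rewrite !ffunE mulrDr mulrDl.
Qed.

Lemma gmulDr : right_distributive gmul +%R.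
Proof.
move=> f g h; apply/ffunP => S; rewrite !ffunE -big_split /=.
by apply: eq_bigr => A _; rewrite !ffunE mulrDr.
Qed.

Lemma gmulA : associative gmul.
Proof.
move=> f g h; apply/ffunP => S; rewrite !ffunE.
under eq_bigr => B _ do rewrite ffunE mulr_sumr.
under [RHS]eq_bigr => A _ do rewrite ffunE mulr_sumr mulr_suml.
rewrite [RHS](exchange_big_dep (fun B => B \subset S)) /=; last first.
  by move=> A B sAS sBA; apply: subset_trans sAS.
apply: eq_bigr => B sBS.
rewrite (reindex_onto (fun A => A :\: B) (fun C => B :|: C)) /=; last first.
  move=> C; rewrite subsetD => /andP[_ dCB].
  by rewrite setDUl setDv set0U; apply/setDidPl.
apply: eq_big => [A|A].
  apply/andP/andP => [[sA /eqP <-]|[sAS sBA]].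
    rewrite subUset sBS subsetUl; split=> //.
    by apply: subset_trans sA _; apply: subsetDl.
  split; first exact: setSD.
  by rewrite -{1}(setIidPr sBA) setID.
move=> /andP[sA /eqP eA].
have sBA : B \subset A by rewrite -eA subsetUl.
have sAS : A \subset S.
  by rewrite -eA subUset sBS (subset_trans sA) ?subsetDl.
have -> : S :\: B :\: (A :\: B) = S :\: A by rewrite setDDl eA.
have eSB : S :\: B = (A :\: B) :|: (S :\: A).
  have sub (T U : {set 'I_n}) i : T \subset U -> i \in T -> i \in U.
    by move=> sTU; apply: (fintype.subsetP sTU).
  apply/setP => i; rewrite !inE.
  move: (sub _ _ i sBA) (sub _ _ i sAS).
  by case: (i \in A) => /=; case: (i \in B); case: (i \in S) => //= a b;
    first [have := a isT | have := b isT].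
have dB : [disjoint B & A :\: B].
  by rewrite disjoint_sym disjoints_subset setDE subsetIr.
have dA : [disjoint A :\: B & S :\: A].
  rewrite disjoint_sym disjoints_subset; apply/fintype.subsetP => i.
  by rewrite !inE => /andP[/negPf -> _]; rewrite andbF.
have eI : inversions A (S :\: A) =
    (inversions B (S :\: A) + inversions (A :\: B) (S :\: A))%N.
  by rewrite -inversionsU // eA.
rewrite eSB inversionsUr // eI !exprD -!mulrA.
rewrite [LHS]mulrCA; congr (_ * _).
rewrite [RHS]mulrCA; congr (_ * _).
by rewrite mulrCA.
Qed.

HB.instance Definition _ := GRing.Zmodule_isPzRing.Build L
  gmulA gmul1f gmulf1 gmulDl gmulDr.

Lemma grassmannZE (a : K) f S : (a *: f) S = a * f S.
Proof. by rewrite ffunE. Qed.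

Lemma grassmannME f g S : (f * g) S = \sum_(A : {set 'I_n} | A \subset S)
  (-1) ^+ inversions A (S :\: A) * f A * g (S :\: A).
Proof. by rewrite ffunE. Qed.

Lemma grassmann_scalerAl (a : K) f g : a *: (f * g) = (a *: f) * g.
Proof.
apply/ffunP => S; rewrite grassmannZE !grassmannME mulr_sumr.
by apply: eq_bigr => A _; rewrite grassmannZE mulrA [in RHS]mulrCA.
Qed.

Lemma grassmann_scalerAr (a : K) f g : a *: (f * g) = f * (a *: g).
Proof.
apply/ffunP => S; rewrite grassmannZE !grassmannME mulr_sumr.
by apply: eq_bigr => A _; rewrite grassmannZE mulrCA.
Qed.

Lemma grassmann_basisE f : f = \sum_S f S *: gbasis S.
Proof.
apply/ffunP => S; rewrite sum_ffunE (bigD1 S) //= big1 => [|T nT].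
  by rewrite grassmannZE ffunE eqxx mulr1 addr0.
by rewrite grassmannZE ffunE eq_sym (negPf nT) mulr0.
Qed.

Lemma grassmann_basisM A B : gbasis A * gbasis B =
  if [disjoint A & B] then (-1) ^+ inversions A B *: gbasis (A :|: B) else 0.
Proof.
apply/ffunP => S; rewrite grassmannME.
case: ifP => [dAB|/negbT nAB]; last first.
  rewrite [RHS]ffunE.
  apply: big1 => C _; rewrite !ffunE; case: eqP => [->|_]; last first.
    by rewrite mulr0 mul0r.
  case: eqP => [eB|_]; last by rewrite mulr0.
  by rewrite -eB disjoint_sym disjoints_subset setDE subsetIr in nAB.
rewrite grassmannZE [in RHS]ffunE; case: eqP => [->|nS].
  rewrite (bigD1 A) ?subsetUl //= big1 => [|C /andP[_ nC]]; last first.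
    by rewrite !ffunE (negPf nC) mulr0 mul0r.
  rewrite !ffunE eqxx setDUl setDv set0U.
  have /setDidPl -> : [disjoint B & A] by rewrite disjoint_sym.
  by rewrite eqxx !mulr1 addr0.
rewrite big1 => [|C sCS]; first by rewrite mulr0.
rewrite !ffunE; case: eqP => [eC|_]; last by rewrite mulr0 mul0r.
case: eqP => [eB|_]; last by rewrite mulr0.
by case: nS; rewrite -eB -eC -{1}(setIidPr sCS) setID.
Qed.

Definition grassmann_gen (i : 'I_n) : L := gbasis [set i].

Lemma grassmann_gen_sqr i : grassmann_gen i * grassmann_gen i = 0.
Proof. by rewrite grassmann_basisM disjoints1 inE eqxx. Qed.

Lemma grassmann_gen_anticomm i j : i != j ->
  grassmann_gen i * grassmann_gen j = - (grassmann_gen j * grassmann_gen i).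
Proof.
move=> nij; rewrite !grassmann_basisM !disjoints1 !inE nij eq_sym nij /=.
rewrite /inversions !big_set1 setUC -scaleNr; congr (_ *: _).
rewrite -(inj_eq val_inj) in nij.
by case: ltngtP nij => // _ _; rewrite expr0 expr1 ?opprK.
Qed.

Lemma grassmann_gen_prod S : \prod_(i in S) grassmann_gen i = gbasis S.
Proof.
have sS : sorted (fun i j : 'I_n => i < j)%N (enum S).
  rewrite {1}/enum_mem -enumT; apply: sorted_filter.
    by move=> i j k; apply: ltn_trans.
  by have := iota_ltn_sorted 0 n; rewrite -val_enum_ord sorted_map.
rewrite -[S in RHS]set_enum -[LHS]big_filter deprecated_filter_index_enum.
elim: (enum S) sS => [_|i s IHs] /=.
  by rewrite big_nil -[LHS]/(gbasis set0); congr (gbasis _).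
move=> ps; rewrite big_cons IHs ?(path_sorted ps) //.
have lts j : j \in s -> (i < j)%N.
  move: ps; rewrite path_sortedE => [/andP[/allP lts _] /lts //|].
  by move=> k l m; apply: ltn_trans.
rewrite grassmann_basisM disjoints1 inE.
case: ifP => [_|/negbFE /lts]; last by rewrite ltnn.
rewrite /inversions big_set1 big1 ?expr0 ?scale1r => [|j].
  by congr (gbasis _); apply/setP => j; rewrite !inE.
by rewrite inE => /lts /ltnW; rewrite leqNgt => /negPf ->.
Qed.

End Grassmann.

From mathcomp Require Import classical_sets.

Local Open Scope classical_set_scope.

Section GrassmannParts.
Variables (K : comPzRingType) (n : nat).
Local Notation L := (grassmann K n).

(* The direct sum of the Lambda_(n,i) over the i that satisfy P, Lambda_(n,i)  *)
(* being the K-span of the products of i distinct generators.                  *)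
Definition graded_sum (P : pred nat) : set L :=
  [set f | exists c : {set 'I_n} -> K,
     f = \sum_(S : {set 'I_n} | P #|S|)
           c S *: \prod_(i in S) grassmann_gen K i].

Definition odd_part : set L := graded_sum odd.

Definition odd_part' : set L := graded_sum (fun i => odd i && (i <= n.-1)%N).

Definition maxideal : set L := graded_sum (leq 1).

(* The ideal power m^k: finite sums of products of k elements of m.            *)
Definition maxideal_pow (k : nat) : set L :=
  [set f | exists2 s : seq (k.-tuple L),
     forall t u, t \in s -> u \in tval t -> maxideal u &
     f = \sum_(t <- s) \prod_(u <- t) u].

Definition odd_ge3 : set L := odd_part `&` maxideal_pow 3.

Definition principal_ideal (f : L) : set L := [set f * g | g in [set: L]].

End GrassmannParts.

Section Automorphisms.
Variables (K : comPzRingType) (n : nat).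
Local Notation L := (grassmann K n).

Record grassmann_aut := GrassmannAut {
  gaut_fun :> L -> L;
  gaut_inv : L -> L;
  gaut_linear : linear gaut_fun;
  gaut_monoid_morphism : monoid_morphism gaut_fun;
  gaut_funK : cancel gaut_fun gaut_inv;
  gaut_invK : cancel gaut_inv gaut_fun
}.

HB.instance Definition _ (s : grassmann_aut) :=
  GRing.isLinear.Build K L L *:%R (gaut_fun s) (gaut_linear s).
HB.instance Definition _ (s : grassmann_aut) :=
  GRing.isMonoidMorphism.Build L L (gaut_fun s) (gaut_monoid_morphism s).

HB.instance Definition _ := gen_eqMixin grassmann_aut.
HB.instance Definition _ := gen_choiceMixin grassmann_aut.

Lemma gautP (s t : grassmann_aut) : s =1 t -> s = t.
Proof.
case: s t => [f f' fl fm fK f'K] [g g' gl gm gK g'K] /= /funext efg.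
case: _ / efg in gl gm gK g'K *.
have efg' : f' = g' by apply/funext => x; rewrite -{1}(g'K x) fK.
case: _ / efg' in gK g'K *.
by congr GrassmannAut; apply: Prop_irrelevance.
Qed.

Definition gaut_one : grassmann_aut :=
  @GrassmannAut id id (fun _ _ _ => erefl) (conj erefl (fun _ _ => erefl))
    (fun _ => erefl) (fun _ => erefl).

Lemma gaut_comp_linear (s t : grassmann_aut) : linear (s \o t).
Proof. by move=> a x y /=; rewrite !linearP. Qed.

Lemma gaut_comp_monoid_morphism (s t : grassmann_aut) :
  monoid_morphism (s \o t).
Proof. by split=> [|x y] /=; rewrite ?rmorph1 ?rmorphM. Qed.

(* The product of G is composition: (s * t) x = s (t x).                       *)
Definition gaut_mul (s t : grassmann_aut) : grassmann_aut :=
  GrassmannAut (gaut_comp_linear s t) (gaut_comp_monoid_morphism s t)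
    (can_comp (gaut_funK s) (gaut_funK t))
    (can_comp (gaut_invK t) (gaut_invK s)).

Lemma gaut_inv_linear (s : grassmann_aut) : linear (gaut_inv s).
Proof.
move=> a x y; apply: (can_inj (gaut_funK s)).
by rewrite gaut_invK linearP /= !gaut_invK.
Qed.

Lemma gaut_inv_monoid_morphism (s : grassmann_aut) :
  monoid_morphism (gaut_inv s).
Proof.
split=> [|x y]; apply: (can_inj (gaut_funK s)).
  by rewrite gaut_invK rmorph1.
by rewrite rmorphM /= !gaut_invK.
Qed.

Definition gaut_invg (s : grassmann_aut) : grassmann_aut :=
  GrassmannAut (gaut_inv_linear s) (gaut_inv_monoid_morphism s)
    (gaut_invK s) (gaut_funK s).

Lemma gaut_mulA : associative gaut_mul.
Proof. by move=> s t u; apply: gautP. Qed.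
Lemma gaut_mul1 : left_id gaut_one gaut_mul.
Proof. by move=> s; apply: gautP. Qed.
Lemma gaut_mulr1 : right_id gaut_one gaut_mul.
Proof. by move=> s; apply: gautP. Qed.
Lemma gaut_mulV : left_inverse gaut_one gaut_invg gaut_mul.
Proof. by move=> s; apply: gautP => x /=; rewrite gaut_funK. Qed.
Lemma gaut_mulVr : right_inverse gaut_one gaut_invg gaut_mul.
Proof. by move=> s; apply: gautP => x /=; rewrite gaut_invK. Qed.

HB.instance Definition _ := isGroup.Build grassmann_aut
  gaut_mulA gaut_mul1 gaut_mulr1 gaut_mulV gaut_mulVr.

Definition Stab (f : L) : set grassmann_aut := [set s | s f = f].

(* s = omega_u for a unit u, with v = u^-1                                     *)
Definition is_omega (u : L) (s : grassmann_aut) : Prop :=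
  exists v : L, [/\ u * v = 1, v * u = 1 & forall x, s x = u * x * v].

Definition is_gamma (b : 'I_n -> L) (s : grassmann_aut) : Prop :=
  forall i, s (grassmann_gen K i) = grassmann_gen K i + b i.

Definition is_sigma (A : 'M[K]_n) (s : grassmann_aut) : Prop :=
  forall i, s (grassmann_gen K i) = \sum_j A i j *: grassmann_gen K j.

(* [unitmx] would require K to be a (nonzero) comUnitRingType.                 *)
Definition GL (A : 'M[K]_n) : Prop :=
  exists B : 'M[K]_n, A *m B = 1%:M /\ B *m A = 1%:M.

Definition Omega : set grassmann_aut :=
  [set s | exists2 a, odd_part' a & is_omega (1 + a) s].

Definition Gamma : set grassmann_aut :=
  [set s | exists2 b, (forall i, odd_ge3 (b i)) & is_gamma b s].

Definition GLop : set grassmann_aut :=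
  [set s | exists2 A, GL A & is_sigma A s].

End Automorphisms.

Section InternalProducts.
Variable G : groupType.
Implicit Types H L S : set G.
Local Open Scope group_scope.

Definition setmul H L : set G := [set x * y | x in H & y in L].

Definition is_subgroup H : Prop :=
  [/\ H 1, forall x y, H x -> H y -> H (x * y) & forall x, H x -> H x^-1].

Definition is_normal_subgroup H S : Prop :=
  [/\ is_subgroup H, H `<=` S & forall x y, H x -> S y -> H (y * x * y^-1)].

(* S is the internal semidirect product H ><| L with normal factor H.          *)
Definition is_semidirect H L S : Prop :=
  [/\ is_subgroup S, is_normal_subgroup H S, is_subgroup L,
      H `&` L = [set 1] & setmul H L = S].

End InternalProducts.

(* Main.v *)
(* Since K is reduced, an automorphism s preserves the filtration by the m^k. *)
(* As 1/2 is in K, the even parts of s f and s g multiply to zero for odd f   *)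
(* and g; hence the parity-preserving part p of s is an automorphism again,   *)
(* and so is the degree-preserving part l of p, while p l^-1 lies in Gamma.   *)
(* The even parts of the s x_i satisfy Koszul relations, which force them to  *)
(* be 2 a p(x_i) for a single odd a: this says s = omega_(1+a) p. All three   *)
(* factors omega_(1+a), p l^-1 and l fix x_1 when s does. Normality comes     *)
(* from reading Omega Gamma as the automorphisms acting trivially on m / m^2. *)

Require Import Defs.
From HB Require Import structures.
From mathcomp Require Import all_boot all_order all_algebra.
From mathcomp Require Import boolp.

Set Implicit Arguments.
Unset Strict Implicit.
Unset Printing Implicit Defensive.

Import GRing.Theory.

Local Open Scope ring_scope.

(** * Filtration, gradings and parity *)

Section Graded.
Variables (K : comPzRingType) (n : nat).
Local Notation L := (grassmann K n).
Local Notation x := (@grassmann_gen K n).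
Local Notation e := (@gbasis K n).
Implicit Types (f g : L) (S T A B : {set 'I_n}).

(** Each automorphism s is split into three factors that are read off from s itself. For this reason
    each factor fixes every generator that s fixes, and the factorization of G restricts to the
    stabilizer.

    Reducedness enters through [aut_gen_order]: s(x_i) squares to zero, so its constant term is
    nilpotent, hence zero, and s preserves the filtration by powers of m ([aut_order]). With 1/2
    available, comparing parities in s(f)s(g) + s(g)s(f) = 0 for odd f, g ([aut_odd_relation]) shows
    that s(f)s(g) involves only the odd parts of s(f) and s(g), and that s keeps even elements even.
    Hence the block-diagonal part p of s for the parity grading is again an automorphism
    ([exists_parity_part]). So is the block-diagonal part l of p for the degree grading
    ([exists_linear_part]). The quotient p l^-1 preserves parity and is trivial on m/m^2, which
    characterizes Gamma ([GammaP]); l is linear ([GLopP]).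

    What remains is the even part of s(x_i). Pulled back by p it gives even u_i with u_j x_i + u_i
    x_j = 0, and [koszul] solves these equations by u_i = a' x_i. Since omega_(1+a) sends x_i to x_i
    + 2 a x_i for odd a, s equals omega_(1+a) p with 2a = p(a') ([omega_even_factor]). Together this
    is [aut_factor].

    The product Omega Gamma consists of the automorphisms trivial on m/m^2 ([unipotent_factor]), a
    condition stable under conjugation. Intersections are trivial because Omega moves x_i by even
    elements and Gamma by odd ones, and because a linear automorphism trivial on m/m^2 is the
    identity. Finally omega_(1+a) fixes x_1 exactly when a x_1 = 0, that is, when a lies in (x_1)
    ([annihilator_gen]). *)

Definition order_ge (k : nat) f := forall S, (#|S| < k)%N -> f S = 0.

Lemma order_geD k f g : order_ge k f -> order_ge k g -> order_ge k (f + g).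
Proof. by move=> hf hg S hS; rewrite ffunE hf ?hg ?addr0. Qed.

Lemma order_geZ k a f : order_ge k f -> order_ge k (a *: f).
Proof. by move=> hf S hS; rewrite grassmannZE hf ?mulr0. Qed.

Lemma order_geN k f : order_ge k f -> order_ge k (- f).
Proof. by move=> hf S hS; rewrite ffunE hf ?oppr0. Qed.

Lemma order_ge_sum k (I : Type) (r : seq I) (P : pred I) (F : I -> L) :
  (forall i, P i -> order_ge k (F i)) -> order_ge k (\sum_(i <- r | P i) F i).
Proof.
move=> hF; apply: big_ind => // [S _|f g]; first by rewrite ffunE.
exact: order_geD.
Qed.

Lemma card_setD_sub A S : A \subset S -> (#|A| + #|S :\: A|)%N = #|S|.
Proof. by move=> sAS; rewrite -(cardsID A S) (setIidPr sAS). Qed.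

Lemma order_geM k l f g :
  order_ge k f -> order_ge l g -> order_ge (k + l) (f * g).
Proof.
move=> hf hg S hS; rewrite grassmannME big1 // => A sAS.
case: (ltnP #|A| k) => [/hf ->|kA]; first by rewrite mulr0 mul0r.
rewrite hg ?mulr0 //; rewrite -(card_setD_sub sAS) in hS.
by rewrite -(ltn_add2l k); apply: leq_ltn_trans hS; rewrite leq_add2r.
Qed.

Lemma order_ge_basis S : order_ge #|S| (e S).
Proof. by move=> T; rewrite ffunE; case: eqP => // ->; rewrite ltnn. Qed.

Lemma order_ge_leq k l f : (l <= k)%N -> order_ge k f -> order_ge l f.
Proof. by move=> lk hf S hS; apply: hf; apply: leq_trans lk. Qed.

Lemma order_ge_prod (I : Type) (r : seq I) (P : pred I) (F : I -> L) :
  (forall i, P i -> order_ge 1 (F i)) ->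
  order_ge (\sum_(i <- r | P i) 1) (\prod_(i <- r | P i) F i).
Proof.
move=> hF; apply: (big_ind2 (fun k f => order_ge k f)) => // k f l g.
exact: order_geM.
Qed.

(** * Gradings by a function of the degree: [d := odd] gives parity, [d := id] the degree itself *)

Section Grading.
Variables (D : eqType) (d : nat -> D).

Definition homog (c : D) f := forall S, d #|S| != c -> f S = 0.

Definition component (c : D) f : L :=
  [ffun S : {set 'I_n} => if d #|S| == c then f S else 0].

Lemma component_is_linear c : linear (component c).
Proof.
move=> a f g; apply/ffunP => S; rewrite !ffunE.
by case: ifP => // _; rewrite scaler0 addr0.
Qed.

HB.instance Definition _ c :=
  GRing.isLinear.Build K L L *:%R (component c) (component_is_linear c).

Lemma homog_component c f : homog c (component c f).
Proof. by move=> S /negPf hS; rewrite ffunE hS. Qed.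

Lemma component_id c f : homog c f -> component c f = f.
Proof. by move=> hf; apply/ffunP => S; rewrite ffunE; case: eqP => // /eqP hS;
  rewrite hf. Qed.

Lemma component_neq c c' f : homog c f -> c' != c -> component c' f = 0.
Proof.
move=> hf nc; apply/ffunP => S; rewrite !ffunE; case: eqP => // e0.
by apply: hf; rewrite e0.
Qed.

Lemma homogD c f g : homog c f -> homog c g -> homog c (f + g).
Proof. by move=> hf hg S hS; rewrite ffunE hf ?hg ?addr0. Qed.

Lemma homogZ c a f : homog c f -> homog c (a *: f).
Proof. by move=> hf S hS; rewrite grassmannZE hf ?mulr0. Qed.

Lemma homogN c f : homog c f -> homog c (- f).
Proof. by move=> hf S hS; rewrite ffunE hf ?oppr0. Qed.

Lemma homog0 c : homog c 0.
Proof. by move=> S _; rewrite ffunE. Qed.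

Lemma homog_sum c (I : Type) (r : seq I) (P : pred I) (F : I -> L) :
  (forall i, P i -> homog c (F i)) -> homog c (\sum_(i <- r | P i) F i).
Proof.
move=> hF; apply: big_ind => //; first exact: homog0.
by move=> f g; apply: homogD.
Qed.

Lemma homog_basis S : homog (d #|S|) (e S).
Proof. by move=> T; rewrite ffunE; case: (T =P S) => // ->; rewrite eqxx. Qed.

Lemma homog_neq c c' f : homog c f -> homog c' f -> c != c' -> f = 0.
Proof.
move=> hc hc' nc; apply/ffunP => S; rewrite ffunE.
by case: (eqVneq (d #|S|) c) => [e0|/hc //]; apply: hc'; rewrite e0.
Qed.

Lemma homog_basisM A B : homog (d (#|A| + #|B|)) (e A * e B).
Proof.
rewrite grassmann_basisM; case: ifP => [dAB|_]; last exact: homog0.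
rewrite -cardsUI (_ : A :&: B = set0) ?cards0 ?addn0.
  by apply: homogZ; apply: homog_basis.
by apply/eqP; rewrite setI_eq0.
Qed.

(** The block-diagonal part of s, the sum over c of pi_c s pi_c with pi_c the projection
    [component c]. *)
Definition gpart (s : grassmann_aut K n) f : L :=
  [ffun T : {set 'I_n} => s (component (d #|T|) f) T].

Lemma gpart_is_linear s : linear (gpart s).
Proof. by move=> a f g; apply/ffunP => S; rewrite !ffunE !linearP /= !ffunE.
Qed.

HB.instance Definition _ s :=
  GRing.isLinear.Build K L L *:%R (gpart s) (gpart_is_linear s).

Lemma gpart_homog s c f : homog c f -> gpart s f = component c (s f).
Proof.
move=> hf; apply/ffunP => T; rewrite !ffunE.
case: eqP => [->|/eqP nc]; first by rewrite component_id.
by rewrite (component_neq hf nc) linear0 ffunE.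
Qed.

Lemma gpart_morphism (s : grassmann_aut K n) :
  (forall A B, component (d (#|A| + #|B|)) (s (e A) * s (e B)) =
    component (d #|A|) (s (e A)) * component (d #|B|) (s (e B))) ->
  monoid_morphism (gpart s).
Proof.
move=> hs; have h1 : homog (d 0) (1 : L).
  by rewrite -[1]/(e set0) -(cards0 'I_n); apply: homog_basis.
split=> [|f g]; first by rewrite (gpart_homog s h1) rmorph1 component_id.
rewrite [f]grassmann_basisE mulr_suml !linear_sum mulr_suml /=.
apply: eq_bigr => A _; rewrite [g]grassmann_basisE mulr_sumr !linear_sum.
rewrite mulr_sumr; apply: eq_bigr => B _ /=.
rewrite -grassmann_scalerAl -grassmann_scalerAr !linearZ /=.
rewrite -grassmann_scalerAl -grassmann_scalerAr.
rewrite (gpart_homog s (@homog_basisM A B)) rmorphM hs.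
by rewrite !(gpart_homog s (@homog_basis _)).
Qed.

(** The hypothesis says pi_c s (1 - pi_c) t pi_c = 0: what t moves out of a block is not brought
    back by s. Hence pi_c s pi_c t pi_c = pi_c s t pi_c = pi_c. *)
Lemma gpartK (s t : grassmann_aut K n) : cancel t s ->
  (forall c f, homog c f -> component c (s (t f - component c (t f))) = 0) ->
  cancel (gpart t) (gpart s).
Proof.
move=> st hst f; apply/ffunP => T; rewrite ffunE.
set c := d #|T|; pose fc := component c f.
have hfc : homog c fc by apply: homog_component.
have -> : component c (gpart t f) = component c (t fc).
  by apply/ffunP => U; rewrite !ffunE; case: eqP => // ->.
have /(congr1 (fun h : L => h T)) := hst c fc hfc.
rewrite raddfB /= st raddfB /= !ffunE eqxx => /eqP.
by rewrite subr_eq0 => /eqP.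
Qed.

End Grading.

(** * Parity and supercommutativity *)

Section Parity.

Lemma homog_oddM b c f g :
  homog odd b f -> homog odd c g -> homog odd (b (+) c) (f * g).
Proof.
move=> hf hg S; rewrite grassmannME => hS; rewrite big1 // => A sAS.
case: (eqVneq (odd #|A|) b) => [eb|/hf ->]; last by rewrite mulr0 mul0r.
rewrite hg ?mulr0 //; apply: contraNneq hS => ec.
by rewrite -(card_setD_sub sAS) oddD eb ec.
Qed.

Lemma homog_odd1 : homog odd false (1 : L).
Proof.
by move=> S hS; rewrite ffunE; case: (S =P set0) hS => // ->; rewrite cards0.
Qed.

Lemma homog_odd_prod (I : Type) (r : seq I) (P : pred I) (F : I -> L) :
  (forall i, P i -> homog odd true (F i)) ->
  homog odd (odd (\sum_(i <- r | P i) 1)) (\prod_(i <- r | P i) F i).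
Proof.
move=> hF; apply: (big_ind2 (fun k f => homog odd (odd k) f)) => //.
  exact: homog_odd1.
by move=> k f l g; rewrite oddD; apply: homog_oddM.
Qed.

Lemma homog_gen i : homog odd true (x i).
Proof. by rewrite -[true]/(odd 1) -(cards1 i); apply: homog_basis. Qed.

Lemma parity_split f : f = component odd true f + component odd false f.
Proof.
by apply/ffunP => S; rewrite !ffunE; case: (odd _); rewrite ?addr0 ?add0r.
Qed.

Lemma inversions_swap A B : [disjoint A & B] ->
  (inversions A B + inversions B A)%N = (#|A| * #|B|)%N.
Proof.
move=> dAB; rewrite /inversions [X in (_ + X)%N]exchange_big -big_split /=.
rewrite -sum_nat_const; apply: eq_bigr => i iA.
rewrite -big_split /= -sum1_card; apply: eq_bigr => j jB.
have : i != j by apply: contraTneq iA => ->; rewrite (disjointFl dAB).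
by rewrite -(inj_eq val_inj) /=; case: ltngtP.
Qed.

(** Complementation in S exchanges the two factors of each term, and by [inversions_swap] the two
    signs differ by (-1)^(|A||B|). *)
Lemma parity_comm b c f g : homog odd b f -> homog odd c g ->
  f * g = (-1) ^+ (b && c) *: (g * f).
Proof.
move=> hf hg; apply/ffunP => S; rewrite grassmannZE !grassmannME mulr_sumr.
rewrite [RHS](reindex_onto (fun A => S :\: A) (fun A => S :\: A)) /=;
  last first.
  by move=> A sAS; rewrite setDDr setDv set0U (setIidPr sAS).
apply: eq_big => [A|A sAS].
  apply/idP/andP => [sAS|[_ /eqP <-]]; last exact: subsetDl.
  by rewrite subsetDl setDDr setDv set0U (setIidPr sAS).
have -> : S :\: (S :\: A) = A by rewrite setDDr setDv set0U (setIidPr sAS).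
case: (eqVneq (odd #|A|) b) => [eb|/hf ->]; last by rewrite !mulr0 mul0r.
case: (eqVneq (odd #|S :\: A|) c) => [ec|/hg ->];
  last by rewrite !(mulr0, mul0r).
rewrite -!mulrA [g _ * f _]mulrC !mulrA -eb -ec -oddM; congr (_ * _ * _).
rewrite signr_odd -inversions_swap; last first.
  by rewrite disjoint_sym disjoints_subset setDE subsetIr.
by rewrite exprD -mulrA -expr2 sqrr_sign mulr1.
Qed.

Lemma even_comm f g : homog odd false f -> f * g = g * f.
Proof.
move=> hf; rewrite [g]parity_split mulrDr mulrDl.
by congr (_ + _); rewrite (parity_comm hf (@homog_component _ odd _ g)) /=
  scale1r.
Qed.

Lemma odd_anticomm f g :
  homog odd true f -> homog odd true g -> f * g = - (g * f).
Proof. by move=> hf hg; rewrite (parity_comm hf hg) expr1 scaleN1r. Qed.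

End Parity.

(** * Multiplication by a generator and its annihilator *)

Lemma mul_genE f i S : (f * x i) S =
  if i \in S then (-1) ^+ inversions (S :\ i) [set i] * f (S :\ i) else 0.
Proof.
rewrite grassmannME; case: ifP => iS.
  have e1 : S :\: (S :\ i) = [set i].
    by rewrite setDDr setDv set0U; apply/setIidPr; rewrite sub1set.
  rewrite (bigD1 (S :\ i)) ?subsetDl //= e1 big1 ?addr0 ?ffunE ?eqxx ?mulr1 //.
  move=> A /andP[sAS nA]; rewrite ffunE; case: eqP => [e0|];
    last by rewrite mulr0.
  by case/eqP: nA; rewrite -e0 setDDr setDv set0U (setIidPr sAS).
rewrite big1 // => A sAS; rewrite ffunE; case: eqP => [e0|];
  last by rewrite mulr0.
by have := set11 i; rewrite -e0 inE iS andbF.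
Qed.

Lemma mul_gen_setU1 f i S : i \notin S ->
  (f * x i) (i |: S) = (-1) ^+ inversions S [set i] * f S.
Proof. by move=> iS; rewrite mul_genE setU11 setU1K. Qed.

Lemma annihilator_gen f i : f * x i = 0 -> exists g, f = g * x i.
Proof.
move=> h.
(* The witness strips x_i from the monomials of f. Its values at sets containing i are harmless, as
   the product with x_i never reads them. *)
exists [ffun S : {set 'I_n} => (-1) ^+ inversions S [set i] * f (i |: S)].
apply/ffunP => S; rewrite mul_genE; case: ifP => [iS|/negbT iS].
  by rewrite ffunE setD1K // mulrA -expr2 sqrr_sign mul1r.
have := congr1 (fun g : L => g (i |: S)) h.
rewrite mul_gen_setU1 // ffunE => /(congr1 (fun a =>
  (-1) ^+ inversions S [set i] * a)).
by rewrite mulr0 mulrA -expr2 sqrr_sign mul1r.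
Qed.

End Graded.
(** * Factorization of an automorphism *)

Section Automorphism.
Variables (K : comPzRingType) (n : nat).
Hypotheses (hred : reduced K) (hhalf : has_half K).
Local Notation L := (grassmann K n).
Local Notation x := (@grassmann_gen K n).
Local Notation e := (@gbasis K n).
Local Notation aut := (grassmann_aut K n).
Implicit Types (f g a : L) (S T A B : {set 'I_n}) (s t : aut).

(** * Action of an automorphism on the filtration and on parity *)

Lemma double_eq0 f : f + f = 0 -> f = 0.
Proof.
have [h hh] := hhalf; move=> /(congr1 ( *:%R h)).
by rewrite scalerDr scaler0 -mulr2n scalerMnl hh scale1r.
Qed.

Lemma odd_sqr0 a : homog odd true a -> a * a = 0.
Proof.
by move=> ha; apply: double_eq0; rewrite {1}(odd_anticomm ha ha) addNr.
Qed.

(** The constant term of s(x_i)^2 = 0 is the square of the constant term of s(x_i), and K is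
    reduced. *)
Lemma aut_gen_order s i : order_ge 1 (s (x i)).
Proof.
move=> S; rewrite ltnS leqn0 cards_eq0 => /eqP ->.
apply: (hred (k := 2)).
have := congr1 (fun f : L => f set0) (rmorphM s (x i) (x i)).
rewrite grassmann_gen_sqr rmorph0 grassmannME (bigD1 set0) ?sub0set //=.
rewrite big1 => [|A /andP[]]; last by rewrite subset0 => /eqP ->; rewrite eqxx.
by rewrite setD0 inversions0l expr0 mul1r addr0 ffunE expr2.
Qed.

Lemma aut_basis s S : s (e S) = \prod_(i in S) s (x i).
Proof. by rewrite -grassmann_gen_prod rmorph_prod. Qed.

Lemma aut_order s k f : order_ge k f -> order_ge k (s f).
Proof.
move=> hf; rewrite [f]grassmann_basisE linear_sum.
apply: order_ge_sum => S _; rewrite linearZ /=.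
case: (ltnP #|S| k) => [/hf ->|kS];
  first by rewrite scale0r => T; rewrite ffunE.
apply: order_geZ; apply: order_ge_leq kS _; rewrite aut_basis -sum1_card.
by apply: order_ge_prod => i _; apply: aut_gen_order.
Qed.

Lemma aut_ext s t : (forall i, s (x i) = t (x i)) -> s = t.
Proof.
move=> st; apply: gautP => f; rewrite [f]grassmann_basisE !linear_sum.
by apply: eq_bigr => S _; rewrite !linearZ /= !aut_basis;
  under eq_bigr do rewrite st.
Qed.

(* Write s f = u + p and s g = v + q with u, v odd and p, q even: since f and g
   anticommute, so do s f and s g, whence 2 p q = 0 and 2 (u q + p v) = 0. *)
Lemma aut_odd_relation s f g : homog odd true f -> homog odd true g ->
  component odd false (s f) * component odd false (s g) = 0 /\
  component odd true (s f) * component odd false (s g) +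
    component odd false (s f) * component odd true (s g) = 0.
Proof.
move=> hf hg.
set u := component odd true (s f); set p := component odd false (s f).
set v := component odd true (s g); set q := component odd false (s g).
have hu : homog odd true u by apply: homog_component.
have hv : homog odd true v by apply: homog_component.
have hp : homog odd false p by apply: homog_component.
have hq : homog odd false q by apply: homog_component.
have h0 : p * q + (u * q + p * v) = 0.
  apply: double_eq0; have : s f * s g + s g * s f = 0.
    by rewrite -!rmorphM -raddfD (odd_anticomm hf hg) addNr raddf0.
  rewrite [s f]parity_split [s g]parity_split -/u -/p -/v -/q.
  rewrite !mulrDl !mulrDr (odd_anticomm hv hu) -(even_comm v hp).
  rewrite (even_comm u hq) -(even_comm p hq) => <-.
  rewrite [RHS](AC ((2*2)*(2*2)) ((1*5)*((4*(2*3))*(8*(7*6))))) /=.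
  by rewrite subrr add0r.
have hpq : homog odd false (p * q) by apply: (homog_oddM hp hq).
have huv : homog odd true (u * q + p * v).
  by apply: homogD; [apply: (homog_oddM hu hq)|apply: (homog_oddM hp hv)].
split.
  have := congr1 (component odd false) h0; rewrite raddfD /= raddf0.
  by rewrite component_id // (component_neq huv) // addr0.
have := congr1 (component odd true) h0; rewrite raddfD /= raddf0.
by rewrite (component_neq hpq) // add0r component_id.
Qed.

Lemma aut_oddM s f g : homog odd true f -> homog odd true g ->
  s f * s g = component odd true (s f) * component odd true (s g).
Proof.
move=> hf hg; have [h1 h2] := aut_odd_relation s hf hg.
rewrite {1}[s f]parity_split {1}[s g]parity_split.
by rewrite mulrDr !mulrDl h1 addr0 -addrA [X in _ + X]addrC h2 addr0.
Qed.

(** A nonconstant even monomial is, up to sign, a product of two odd ones; by [aut_oddM] its image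
    is a product of two odd elements. *)
Lemma aut_even s f : homog odd false f -> homog odd false (s f).
Proof.
move=> hf; rewrite [f]grassmann_basisE linear_sum.
apply: homog_sum => S _; rewrite linearZ /=.
case oS: (odd #|S|); first by rewrite hf ?oS // scale0r; apply: homog0.
apply: homogZ; case: (set_0Vmem S) => [->|[i iS]].
  by rewrite -[e set0]/(1 : L) rmorph1; apply: homog_odd1.
have hS : homog odd true (e (S :\ i)).
  suff <- : odd #|S :\ i| = true by apply: homog_basis.
  by move: oS; rewrite (cardsD1 i) iS /= => /negbFE.
have -> : e S = (-1) ^+ inversions [set i] (S :\ i) *: (x i * e (S :\ i)).
  rewrite grassmann_basisM disjoints1 !inE eqxx /= setD1K //.
  by rewrite scalerA -expr2 sqrr_sign scale1r.
rewrite linearZ /= rmorphM aut_oddM //; last exact: homog_gen.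
apply: homogZ; apply: (@homog_oddM _ _ true true); exact: homog_component.
Qed.

Lemma component_evenM b f g : homog odd false f ->
  component odd b (f * g) = f * component odd b g.
Proof.
move=> hf; rewrite {1}[g]parity_split mulrDr raddfD /=.
have h c : homog odd c (f * component odd c g).
  by apply: (homog_oddM hf); apply: homog_component.
case: b.
  by rewrite component_id // (component_neq (h false)) // addr0.
by rewrite (component_neq (h true)) // component_id // add0r.
Qed.

(** Leading forms multiply: in total degree i + j, only the terms of degrees exactly i and j can
    contribute. *)
Lemma component_orderM i j f g : order_ge i f -> order_ge j g ->
  component id (i + j) (f * g) = component id i f * component id j g.
Proof.
move=> hf hg; apply/ffunP => T; rewrite ffunE !grassmannME.
case: (#|T| =P (i + j)%N) => hT.
  apply: eq_bigr => A sAT; rewrite !ffunE /=.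
  move: hT; rewrite -(card_setD_sub sAT) => hT.
  case: (ltngtP #|A| i) => [lA|gA|eA]; first by rewrite hf // !(mulr0, mul0r).
    rewrite hg ?mulr0 ?mul0r // -(ltn_add2l i) -hT ltn_add2r //.
  by move: hT; rewrite eA => /addnI ->; rewrite eqxx.
rewrite big1 // => A sAT; rewrite !ffunE /=.
case: (#|A| =P i) => [eA|_]; last by rewrite mulr0 mul0r.
case: (#|_ :\: _| =P j) => [eB|_]; last by rewrite mulr0.
by case: hT; rewrite -(card_setD_sub sAT) eA eB.
Qed.

(** * The parity-preserving and degree-preserving parts of an automorphism *)

Lemma gpart_aut (D : eqType) (d : nat -> D) s :
  (forall t A B, component d (d (#|A| + #|B|)) (t (e A) * t (e B)) =
    component d (d #|A|) (t (e A)) * component d (d #|B|) (t (e B))) ->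
  (forall t t' c f, homog d c f ->
    component d c (t' (t f - component d c (t f))) = 0) ->
  exists p : aut, forall c f, homog d c f -> p f = component d c (s f).
Proof.
(* The hypotheses range over all automorphisms, so they apply to s and to its inverse; the diagonal
   parts of the two are then mutually inverse. *)
move=> hM hK; pose t := gaut_invg s.
have st : cancel s t by apply: gaut_funK.
have ts : cancel t s by apply: gaut_invK.
exists (GrassmannAut (@gpart_is_linear _ _ _ d s) (gpart_morphism (hM s))
  (gpartK st (hK s t)) (gpartK ts (hK t s))) => c f hf /=.
exact: gpart_homog.
Qed.

Lemma exists_parity_part s : exists p : aut,
  forall c f, homog odd c f -> p f = component odd c (s f).
Proof.
apply: gpart_aut => [t A B|t t' [] f hf].
- have hA := @homog_basis K n _ odd A; have hB := @homog_basis K n _ odd B.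
  rewrite oddD; case oA: (odd #|A|) hA => hA; last first.
    have hA' := aut_even t hA.
    by rewrite (component_evenM _ _ hA') (component_id hA').
  case oB: (odd #|B|) hB => hB; last first.
    have hB' := aut_even t hB; rewrite (component_id hB').
    by rewrite -!(even_comm _ hB') (component_evenM _ _ hB').
  rewrite (aut_oddM t hA hB) component_id //.
  by apply: (@homog_oddM _ _ true true); apply: homog_component.
- apply: (@component_neq _ _ _ odd false) => //; apply: aut_even.
  rewrite {1}[t f]parity_split addrAC subrr add0r; exact: homog_component.
- by rewrite [component _ _ (t f)]component_id ?subrr ?raddf0 //;
    apply: aut_even.
Qed.

Lemma homog_order k f : homog id k f -> order_ge k f.
Proof. by move=> hf S /ltn_eqF hS; apply: hf; rewrite hS. Qed.

Lemma component_order k f : order_ge k.+1 f -> component id k f = 0.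
Proof.
move=> hf; apply/ffunP => S; rewrite !ffunE.
by case: eqP => //= hS; apply: hf; rewrite hS.
Qed.

Lemma order_component k f : order_ge k f ->
  order_ge k.+1 (f - component id k f).
Proof.
move=> hf S; rewrite ltnS leq_eqVlt !ffunE /= => /orP[/eqP ->|lS].
  by rewrite eqxx subrr.
by rewrite ltn_eqF // hf // subr0.
Qed.

(** On degree k, s equals its leading form up to order k+1, and no automorphism brings order k+1
    back to degree k. *)
Lemma exists_linear_part s : exists p : aut,
  forall k f, homog id k f -> p f = component id k (s f).
Proof.
apply: gpart_aut => [t A B|t t' k f hf].
  by apply: component_orderM; apply: aut_order; apply: order_ge_basis.
apply: component_order; apply: aut_order; apply: order_component.
by apply: aut_order; apply: homog_order.
Qed.

(** The coefficient of a at S can be read off from u_j for any j outside S. The relation for i and j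
    makes the reading independent of j; the relation for i = j, halved, gives u_i x_i = 0, so only
    monomials containing x_i occur in u_i. *)
Lemma koszul (u : 'I_n -> L) :
  (forall i j, u j * x i + u i * x j = 0) -> exists a, forall i, u i = a * x i.
Proof.
move=> hu; pose c (S : {set 'I_n}) : K :=
  if [pick j | j \notin S] is Some j
  then (-1) ^+ inversions S [set j] * u j (j |: S) else 0.
exists [ffun S : {set 'I_n} => c S] => i.
apply/ffunP => T; rewrite mul_genE; case: ifP => [iT|/negbT iT]; last first.
  have /(congr1 (fun f : L => f (i |: T))) := double_eq0 (hu i i).
  rewrite mul_gen_setU1 // [RHS]ffunE.
  move=> /(congr1 (fun z => (-1) ^+ inversions T [set i] * z)).
  by rewrite mulr0 mulrA -expr2 sqrr_sign mul1r.
rewrite ffunE /c -{1}(setD1K iT); set S := T :\ i.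
have iS : i \notin S by rewrite !inE eqxx.
case: pickP => [j jS|/(_ i)]; last by rewrite iS.
case: (eqVneq j i) => [->|nij]; first by rewrite mulrA -expr2 sqrr_sign mul1r.
have inv_pair (k l : 'I_n) : inversions [set k] [set l] = (l < k)%N.
  by rewrite /inversions !big_set1.
have invU (k l : 'I_n) : k \notin S ->
    inversions (k |: S) [set l] = ((l < k) + inversions S [set l])%N.
  by move=> kS; rewrite inversionsU ?disjoints1 // inv_pair.
(* The coefficient of this monomial compares the readings through i and through j; the two signs
   differ by the relative order of i and j. *)
have := congr1 (fun f : L => f (i |: (j |: S))) (hu i j).
rewrite ffunE mul_gen_setU1; last by rewrite in_setU1 negb_or eq_sym nij.
rewrite setUCA mul_gen_setU1; last by rewrite in_setU1 negb_or nij.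
rewrite !invU // ffunE !exprD.
set P := (-1) ^+ inversions S [set i]; set Q := (-1) ^+ inversions S [set j].
move=> h; have {h} h : Q * u i (i |: S) = P * u j (j |: S).
  move: h nij; rewrite -(inj_eq val_inj) /=; case: ltngtP => // _ /eqP + _.
    by rewrite expr0 expr1 mul1r mulN1r mulNr addrC subr_eq0 => /eqP.
  by rewrite expr0 expr1 mul1r mulN1r mulNr subr_eq0 => /eqP.
by rewrite mulrCA -h mulrA -expr2 sqrr_sign mul1r.
Qed.

Lemma component_mul_gen b f i :
  component odd b (f * x i) = component odd (~~ b) f * x i.
Proof.
have h c : homog odd (~~ c) (component odd c f * x i).
  rewrite -addbT; apply: homog_oddM (@homog_gen _ _ i); exact: homog_component.
rewrite {1}[f]parity_split mulrDl raddfD /=; case: b.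
  by rewrite (component_neq (h true)) // (component_id (h false)) add0r.
by rewrite (component_id (h true)) (component_neq (h false)) // addr0.
Qed.

Lemma koszul_odd (u : 'I_n -> L) : (forall i, homog odd false (u i)) ->
  (forall i j, u j * x i + u i * x j = 0) ->
  exists2 a, homog odd true a & forall i, u i = a * x i.
Proof.
move=> hu /koszul[a ha]; exists (component odd true a) => [|i].
  exact: homog_component.
by rewrite -[LHS](component_id (hu i)) ha component_mul_gen.
Qed.

(** * Conjugation by 1 + a for odd a, where 1 - a is the inverse because a^2 = 0 *)

Definition omega_by a s := forall f, s f = (1 + a) * f * (1 - a).

Lemma omega_unit a : homog odd true a ->
  (1 + a) * (1 - a) = 1 /\ (1 - a) * (1 + a) = 1.
Proof.
move=> ha; have a0 := odd_sqr0 ha.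
rewrite !mulrDl !mulrDr !mul1r !mulr1 !mulNr !mulrN a0 oppr0 !addr0.
by rewrite subrK addrK.
Qed.

Lemma omega_exists a : homog odd true a -> exists s, omega_by a s.
Proof.
move=> ha; have [h1 h2] := omega_unit ha.
pose F f : L := (1 + a) * f * (1 - a); pose G f : L := (1 - a) * f * (1 + a).
have F_lin : linear F.
  move=> c f g; rewrite /F; move: (1 + a) (1 - a) => u v; rewrite mulrDr mulrDl.
  by rewrite -grassmann_scalerAr -grassmann_scalerAl.
have F_mul : monoid_morphism F.
  split=> [|f g]; first by rewrite /F mulr1.
  by rewrite /F !mulrA -[_ * (1 - a) * (1 + a)]mulrA h2 mulr1.
have FK : cancel F G.
  by move=> f; rewrite /F /G !mulrA h2 mul1r -mulrA h2 mulr1.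
have GK : cancel G F.
  by move=> f; rewrite /F /G !mulrA h1 mul1r -mulrA h1 mulr1.
by exists (GrassmannAut F_lin F_mul FK GK).
Qed.

Lemma omega_even a s f : homog odd true a -> omega_by a s ->
  homog odd false f -> s f = f.
Proof.
move=> ha hs hf; rewrite hs -(even_comm _ hf) -mulrA.
by have [-> _] := omega_unit ha; rewrite mulr1.
Qed.

(** Here a anticommutes with f, so -f a = a f, and a f a = -a^2 f = 0. *)
Lemma omega_odd a s f : homog odd true a -> omega_by a s ->
  homog odd true f -> s f = f + (a * f + a * f).
Proof.
move=> ha hs hf; rewrite hs mulrDl mul1r mulrBr mulr1 mulrDl.
rewrite (odd_anticomm hf ha) -mulrA (odd_anticomm hf ha) mulrN mulrA.
by rewrite (odd_sqr0 ha) mul0r oppr0 addr0 opprK addrA.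
Qed.

Lemma omega_byP a s : homog odd true a ->
  omega_by a s <-> forall i, s (x i) = x i + (a * x i + a * x i).
Proof.
move=> ha; split=> [hs i|hs]; first exact: omega_odd (@homog_gen _ _ i).
have [t ht] := omega_exists ha; suff -> : s = t by [].
by apply: aut_ext => i; rewrite hs (omega_odd ha ht (@homog_gen _ _ i)).
Qed.

Lemma is_omegaP a s : homog odd true a -> is_omega (1 + a) s <-> omega_by a s.
Proof.
move=> ha; have [h1 h2] := omega_unit ha.
split=> [[v [h3 _ hs]] f|hs]; last by exists (1 - a).
by rewrite hs -[v]mul1r -[X in X * v]h2 -(mulrA (1 - a)) h3 mulr1.
Qed.

(** * Coefficient descriptions of the graded spans, of Omega and of m^3 *)

Lemma graded_sumP (P : pred nat) f :
  graded_sum P f <-> forall S, ~~ P #|S| -> f S = 0.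
Proof.
split=> [[c ->] S hS|hf].
  rewrite sum_ffunE big1 // => T hT; rewrite grassmann_gen_prod grassmannZE.
  by rewrite ffunE; case: (S =P T) hS => [->|]; rewrite ?hT // mulr0.
exists f; rewrite {1}[f]grassmann_basisE (bigID (fun S => P #|S|)) /=.
rewrite [X in _ + X]big1 ?addr0 => [|S /hf ->]; last by rewrite scale0r.
by apply: eq_bigr => S _; rewrite grassmann_gen_prod.
Qed.

Lemma odd_partP f : odd_part f <-> homog odd true f.
Proof.
split=> [/graded_sumP hf S|hf]; first by rewrite eqb_id; apply: hf.
by apply/graded_sumP => S hS; apply: hf; rewrite eqb_id.
Qed.

Lemma maxidealP f : maxideal f <-> order_ge 1 f.
Proof.
split=> [/graded_sumP hf S|hf]; first by rewrite ltnNge; apply: hf.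
by apply/graded_sumP => S; rewrite -ltnNge; apply: hf.
Qed.

(* The component of degree n of a can be dropped: it kills the generators. *)
Lemma OmegaP s : Omega s <-> exists2 a, homog odd true a & omega_by a s.
Proof.
split=> [[a /graded_sumP ha hs]|[a ha hs]].
  have ha' : homog odd true a.
    by move=> S; rewrite eqb_id => hS; apply: ha; rewrite negb_and hS.
  by exists a => //; apply/(is_omegaP _ ha').
pose a' : L := [ffun S : {set 'I_n} => if (#|S| <= n.-1)%N then a S else 0].
have ha' : homog odd true a' by move=> S hS; rewrite ffunE ha // if_same.
exists a'.
  apply/graded_sumP => S; rewrite negb_and ffunE => /orP[hS|/negPf -> //].
  by rewrite ha ?if_same // eqb_id.
apply/(is_omegaP _ ha')/(omega_byP _ ha') => i.
have -> : a' * x i = a * x i; last exact: ((omega_byP s ha).1 hs).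
apply/ffunP => S; rewrite !mul_genE; case: ifP => // iS; rewrite ffunE.
suff -> : (#|S :\ i| <= n.-1)%N by [].
rewrite -ltnS prednK; last exact: leq_ltn_trans (ltn_ord i).
by have := max_card (mem S); rewrite card_ord (cardsD1 i) iS.
Qed.

Lemma maxideal_pow3P f : maxideal_pow 3 f <-> order_ge 3 f.
Proof.
split=> [[s hs ->]|hf].
  rewrite big_seq; apply: order_ge_sum => t ts.
  suff h (r : seq L) : (forall u, u \in r -> maxideal u) ->
      order_ge (size r) (\prod_(u <- r) u).
    by have := h t (fun u => hs t u ts); rewrite size_tuple.
  move=> hr; rewrite -sum1_size big_seq [X in order_ge _ X]big_seq.
  by apply: order_ge_prod => u /hr /maxidealP.
have add g h : maxideal_pow 3 g -> maxideal_pow 3 h -> maxideal_pow 3 (g + h).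
  move=> [s hs ->] [t ht ->]; exists (s ++ t); last by rewrite big_cat.
  by move=> r u; rewrite mem_cat => /orP[/hs|/ht]; apply.
rewrite [f]grassmann_basisE; apply: big_ind => //.
  by exists [::]; rewrite ?big_nil.
move=> S _; case: (ltnP #|S| 3) => [/hf ->|].
  by rewrite scale0r; exists [::]; rewrite ?big_nil.
rewrite cardE -[e S]grassmann_gen_prod.
rewrite -[\prod_(i in S) _]big_filter deprecated_filter_index_enum.
case: (enum S) => [|i [|j [|k s]]] // _.
(* One triple suffices for a monomial of degree at least 3: the third factor absorbs the scalar and
   all further generators. *)
exists [:: [tuple x i; x j; f S *: (x k * \prod_(l <- s) x l)]].
  have hx m : order_ge 1 (x m) by rewrite -(cards1 m); apply: order_ge_basis.
  move=> t u; rewrite inE => /eqP ->; rewrite !inE => /or3P[] /eqP ->;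
    apply/maxidealP => //.
  apply: order_geZ; rewrite -[1%N]addn0; exact: order_geM.
rewrite big_seq1 /= !big_cons big_nil mulr1.
by rewrite -!grassmann_scalerAr.
Qed.

Lemma odd_order3 f : homog odd true f -> order_ge 2 f -> order_ge 3 f.
Proof.
move=> ho hf S; rewrite ltnS leq_eqVlt => /orP[/eqP hS|/hf //].
by apply: ho; rewrite hS.
Qed.

Lemma odd_order1 f : homog odd true f -> order_ge 1 f.
Proof. by move=> ho S; rewrite ltnS leqn0 => /eqP hS; apply: ho; rewrite hS.
Qed.

(** * Automorphisms trivial on m/m^2, parity-preserving ones and linear ones; the characterizations
    of Gamma and GL^op *)

Definition unipotent s := forall f, order_ge 1 f -> order_ge 2 (s f - f).

Definition even_aut s := forall c f, homog odd c f -> homog odd c (s f).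

Definition graded_aut s := forall i, homog id 1%N (s (x i)).

Lemma gen_order i : order_ge 1 (x i).
Proof. by rewrite -(cards1 i); apply: order_ge_basis. Qed.

Lemma unipotent_gen s :
  (forall i, order_ge 2 (s (x i) - x i)) -> unipotent s.
Proof.
move=> hs f hf; rewrite [f]grassmann_basisE linear_sum -sumrB.
apply: order_ge_sum => S _; rewrite linearZ /= -scalerBr.
case: (ltngtP #|S| 1%N) => [/hf ->|gS|/eqP/cards1P[i ->]].
- by rewrite scale0r => T; rewrite ffunE.
- have hS := order_ge_leq gS (@order_ge_basis K n S).
  by apply: order_geZ; apply: order_geD; [apply: aut_order|apply: order_geN].
- exact: order_geZ (hs i).
Qed.

Lemma even_aut_gen s : (forall i, homog odd true (s (x i))) -> even_aut s.
Proof.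
move=> hs c f hf; rewrite [f]grassmann_basisE linear_sum.
apply: homog_sum => S _; rewrite linearZ /=.
case: (odd #|S| =P c) => [<-|/eqP/hf ->]; last first.
  by rewrite scale0r; apply: homog0.
by apply: homogZ; rewrite aut_basis -sum1_card; apply: homog_odd_prod.
Qed.

Lemma unipotentM s t : unipotent s -> unipotent t -> unipotent (s * t)%g.
Proof.
move=> hs ht f hf; rewrite -[_ - f](subrKA (t f)); apply: order_geD.
  by apply: hs; apply: aut_order.
exact: ht.
Qed.

Lemma unipotentV s : unipotent s -> unipotent s^-1%g.
Proof.
move=> hs f hf; have -> : (s^-1)%g f - f = - (s^-1)%g (s f - f).
  by rewrite raddfB /= gaut_funK opprB.
by apply: order_geN; apply: aut_order; apply: hs.
Qed.

Lemma unipotentJ s t : unipotent s -> unipotent (t * s * t^-1)%g.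
Proof.
move=> hs f hf; have -> : (t * s * t^-1)%g f - f =
    t (s ((t^-1)%g f) - (t^-1)%g f) by rewrite raddfB /= gaut_invK.
by apply: aut_order; apply: hs; apply: aut_order.
Qed.

Lemma even_autM s t : even_aut s -> even_aut t -> even_aut (s * t)%g.
Proof. by move=> hs ht c f /ht /hs. Qed.

(** The component of s^-1(f) of the wrong parity has an image of both parities, so it vanishes by
    injectivity. *)
Lemma even_autV s : even_aut s -> even_aut s^-1%g.
Proof.
move=> hs c f hf; set g := (s^-1)%g f.
have hg : s (component odd (~~ c) g) = 0.
  apply: (@homog_neq _ _ _ odd (~~ c) c); last by case: (c).
    by apply: hs; apply: homog_component.
  have -> : component odd (~~ c) g = g - component odd c g.
    rewrite {2}[g]parity_split; case: (c) => /=;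
      first by rewrite addrAC subrr add0r.
    by rewrite addrK.
  rewrite raddfB /= gaut_invK; apply: homogD => //.
  by apply: homogN; apply: hs; apply: homog_component.
have {hg} hg : component odd (~~ c) g = 0.
  by apply: (can_inj (gaut_funK s)); rewrite hg raddf0.
suff -> : g = component odd c g by apply: homog_component.
by rewrite {1}[g]parity_split; case: (c) hg => /= ->; rewrite ?addr0 ?add0r.
Qed.

(** An odd element of order at least 2 has order at least 3, so triviality on m/m^2 already puts the
    b_i in m^3. *)
Lemma GammaP s : Gamma s <-> even_aut s /\ unipotent s.
Proof.
split=> [[b hb hs]|[he hu]].
  have hb' i : homog odd true (b i) /\ order_ge 3 (b i).
    by have [/odd_partP + /maxideal_pow3P] := hb i.
  split; [apply: even_aut_gen|apply: unipotent_gen] => i; rewrite hs.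
    apply: homogD; [exact: homog_gen|by have [] := hb' i].
  rewrite addrAC subrr add0r; apply: (@order_ge_leq _ _ 3) => //.
  by have [] := hb' i.
exists (fun i => s (x i) - x i) => [i|i]; last by rewrite addrC subrK.
have ho : homog odd true (s (x i) - x i).
  by apply: homogD; [apply: he|apply: homogN]; apply: homog_gen.
split; first exact/odd_partP.
by apply/maxideal_pow3P; apply: odd_order3 => //; apply: hu; apply: gen_order.
Qed.

Lemma homog1E f : homog id 1%N f -> f = \sum_i f [set i] *: x i.
Proof.
move=> hf; apply/ffunP => S; rewrite sum_ffunE.
case: (boolP (#|S| == 1%N)) => [/cards1P[i ->]|hS].
  rewrite (bigD1 i) //= big1 => [|j nj]; last first.
    rewrite grassmannZE ffunE; case: eqP => [/set1_inj eij|_];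
      last by rewrite mulr0.
    by rewrite eij eqxx in nj.
  by rewrite grassmannZE ffunE eqxx mulr1 addr0.
rewrite hf // big1 // => i _; rewrite grassmannZE ffunE.
by case: eqP => [eS|_]; [rewrite eS cards1 in hS|rewrite mulr0].
Qed.

Lemma graded_aut_homog1 s f :
  graded_aut s -> homog id 1%N f -> homog id 1%N (s f).
Proof.
move=> hs hf; rewrite (homog1E hf) linear_sum; apply: homog_sum => j _.
by rewrite linearZ /=; apply: homogZ.
Qed.

Lemma graded_autM s t : graded_aut s -> graded_aut t -> graded_aut (s * t)%g.
Proof. by move=> hs ht i; apply: (graded_aut_homog1 hs). Qed.

Lemma graded_autV s : graded_aut s -> graded_aut s^-1%g.
Proof.
move=> hs i; set y := (s^-1)%g (x i); pose y1 := component id 1%N y.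
have hy1 : homog id 1%N y1 by apply: homog_component.
have hsy1 := graded_aut_homog1 hs hy1.
(* This element is homogeneous of degree 1 and also of order at least 2. *)
have hy2 : s (y - y1) = 0.
  have ho : order_ge 2 (s (y - y1)).
    by apply: aut_order; apply: order_component; apply: aut_order;
      apply: gen_order.
  have hh : homog id 1%N (s (y - y1)).
    rewrite raddfB /= gaut_invK; apply: homogD; last exact: homogN.
    by rewrite -(cards1 i); apply: homog_basis.
  by rewrite -(component_id hh); apply: component_order.
suff -> : y = y1 by [].
apply/eqP; rewrite -subr_eq0; apply/eqP.
by apply: (can_inj (gaut_funK s)); rewrite hy2 raddf0.
Qed.

(** The coefficients of t(s(x_i)) form row i of the matrix of s times that of t: matrices multiply
    in the order opposite to composition. *)
Lemma sigma_mulmx s t : graded_aut s -> graded_aut t -> cancel s t ->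
  (\matrix_(i, j) s (x i) [set j]) *m (\matrix_(i, j) t (x i) [set j]) = 1%:M.
Proof.
move=> hs ht st; apply/matrixP => i k; rewrite !mxE.
have := congr1 (fun f : L => f [set k]) (st (x i)).
rewrite {1}(homog1E (hs i)) linear_sum sum_ffunE /= ffunE => h.
rewrite -[RHS]/((i == k)%:R).
rewrite -(inj_eq (@set1_inj _)) eq_sym -h.
by apply: eq_bigr => j _; rewrite !mxE linearZ /= grassmannZE.
Qed.

Lemma GLopP s : GLop s <-> graded_aut s.
Proof.
split=> [[A _ hs] i|hs].
  rewrite hs; apply: homog_sum => j _; apply: homogZ.
  by rewrite -(cards1 j); apply: homog_basis.
have hV := graded_autV hs.
exists (\matrix_(i, j) s (x i) [set j]).
  exists (\matrix_(i, j) (s^-1)%g (x i) [set j]).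
  by split; apply: sigma_mulmx => // f; rewrite ?gaut_funK ?gaut_invK.
by move=> i; rewrite [LHS](homog1E (hs i)); apply: eq_bigr => j _; rewrite mxE.
Qed.

(** * Group laws in Omega, conjugation, and trivial intersections *)

Lemma mul_gen_even a i : homog odd true a -> homog odd false (a * x i).
Proof. by move=> ha; apply: (@homog_oddM _ _ true true) => //;
  apply: homog_gen. Qed.

(** The correction 2 b x_i made by t is even, hence fixed by s, so the two corrections of x_i add
    up. *)
Lemma omega_byM a b s t : homog odd true a -> homog odd true b ->
  omega_by a s -> omega_by b t -> omega_by (a + b) (s * t)%g.
Proof.
move=> ha hb hs ht; apply/(omega_byP _ (homogD ha hb)) => i /=.
rewrite (omega_odd hb ht (@homog_gen _ _ i)) raddfD /=.
rewrite (omega_odd ha hs (@homog_gen _ _ i)) (omega_even ha hs).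
  by rewrite mulrDl -addrA; congr (_ + _); rewrite addrACA.
by apply: homogD; apply: mul_gen_even.
Qed.

Lemma omega_byV a s : homog odd true a -> omega_by a s -> omega_by (- a) s^-1%g.
Proof.
move=> ha hs f; apply: (can_inj (gaut_funK s)); rewrite gaut_invK hs opprK.
have [h _] := omega_unit ha.
by rewrite !mulrA h mul1r -mulrA h mulr1.
Qed.

Lemma omega_byJ a s t : omega_by a s -> omega_by (t a) (t * s * t^-1)%g.
Proof.
by move=> hs f; rewrite /= hs !rmorphM /= raddfB raddfD /= rmorph1 gaut_invK.
Qed.

Lemma omega_by_unipotent a s : homog odd true a -> omega_by a s -> unipotent s.
Proof.
move=> ha hs; apply: unipotent_gen => i.
rewrite (omega_odd ha hs (@homog_gen _ _ i)) addrAC subrr add0r.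
have h : order_ge 2 (a * x i).
  by apply: (@order_geM _ _ 1 1); [apply: odd_order1|apply: gen_order].
exact: order_geD.
Qed.

Lemma Omega_unipotent s : Omega s -> unipotent s.
Proof. by move=> /OmegaP[a ha hs]; apply: omega_by_unipotent hs. Qed.

Lemma OmegaM s t : Omega s -> Omega t -> Omega (s * t)%g.
Proof.
move=> /OmegaP[a ha hs] /OmegaP[b hb ht]; apply/OmegaP.
by exists (a + b); [apply: homogD|apply: omega_byM].
Qed.

Lemma OmegaV s : Omega s -> Omega s^-1%g.
Proof.
move=> /OmegaP[a ha hs]; apply/OmegaP.
by exists (- a); [apply: homogN|apply: omega_byV].
Qed.

Lemma Omega1 : Omega (1%g : aut).
Proof.
apply/OmegaP; exists 0; first exact: homog0.
by move=> f; rewrite addr0 subr0 mul1r mulr1.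
Qed.

Lemma OmegaJ s t : even_aut t -> Omega s -> Omega (t * s * t^-1)%g.
Proof.
move=> ht /OmegaP[a ha hs]; apply/OmegaP.
by exists (t a); [apply: ht|apply: omega_byJ].
Qed.

(** The difference s(x_i) - x_i = 2 a x_i is even, but odd when s preserves parity. *)
Lemma Omega_even_eq1 s : Omega s -> even_aut s -> s = 1%g.
Proof.
move=> /OmegaP[a ha hs] he; apply: aut_ext => i /=.
have hi := @homog_gen K n i; apply/eqP; rewrite -subr_eq0; apply/eqP.
apply: (@homog_neq _ _ _ odd true false) => //.
  by apply: homogD; [apply: he|apply: homogN].
rewrite (omega_odd ha hs hi) addrAC subrr add0r.
by apply: homogD; apply: mul_gen_even.
Qed.

Lemma graded_unipotent_eq1 s : graded_aut s -> unipotent s -> s = 1%g.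
Proof.
move=> hg hu; apply: aut_ext => i /=.
have h : homog id 1%N (s (x i) - x i).
  apply: homogD => //; apply: homogN.
  by rewrite -(cards1 i); apply: homog_basis.
apply/eqP; rewrite -subr_eq0; apply/eqP; rewrite -(component_id h).
by apply: component_order; apply: hu; apply: gen_order.
Qed.

(* With p the parity-preserving part of s and e_i the even part of s x_i, the
   elements u_i = p^-1 e_i satisfy the relations of koszul_odd; then s is
   omega_(1+a) p for a = p(a') / 2, where u_i = a' x_i. *)
Lemma omega_even_factor s (p : aut) :
  (forall c f, homog odd c f -> p f = component odd c (s f)) ->
  exists2 w, Omega w & s = (w * p)%g.
Proof.
move=> hp; have [t tp pt] : exists2 t : aut, cancel p t & cancel t p.
  by exists p^-1%g; [apply: gaut_funK|apply: gaut_invK].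
pose u i := t (component odd false (s (x i))).
have hu i : homog odd false (u i) by apply: aut_even; apply: homog_component.
have hi := @homog_gen K n.
have [i j|a' ha' ua'] := koszul_odd hu.
  have [_ /(congr1 t)] := aut_odd_relation s (hi i) (hi j).
  rewrite -(hp true _ (hi i)) -(hp true _ (hi j)) raddfD raddf0 /=.
  by rewrite !rmorphM /= !tp -(even_comm _ (hu j)).
have [h hh] := hhalf.
have hpa : homog odd true (p a') by rewrite (hp true) //;
  apply: homog_component.
pose a : L := h *: p a'; have ha : homog odd true a by apply: homogZ.
have aa f : a * f + a * f = p a' * f.
  by rewrite -mulrDl -scalerDl -mulr2n hh scale1r.
have [w hw] := omega_exists ha; exists w; first by apply/OmegaP; exists a.
apply: aut_ext => i /=.
rewrite (omega_odd ha hw) ?aa;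
  last by rewrite (hp true) //; apply: homog_component.
by rewrite -rmorphM /= -ua' /u pt (hp true) // -parity_split.
Qed.

(** The factors are w, p l^-1 and l, with p the parity part of s and l the linear part of p. If s
    fixes x_i, so does p, since x_i is odd; so does l, since x_i has degree 1; then w does too. *)
Lemma aut_factor s : exists w g l : aut, [/\ Omega w, Gamma g, GLop l,
  s = (w * g * l)%g & forall i, s (x i) = x i ->
    [/\ w (x i) = x i, g (x i) = x i & l (x i) = x i]].
Proof.
have [p hp] := exists_parity_part s; have [w hw sw] := omega_even_factor hp.
have [l hl] := exists_linear_part p.
have hi1 i : homog id 1%N (x i) by rewrite -(cards1 i); apply: homog_basis.
have lg : graded_aut l by move=> i; rewrite (hl 1%N) //; apply: homog_component.
have pe : even_aut p by move=> c f hf; rewrite (hp c) //;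
  apply: homog_component.
have le : even_aut l.
  apply: even_aut_gen => i S; rewrite eqb_id => hS; apply: lg.
  by apply: contraNneq hS => ->.
exists w, (p * l^-1)%g, l; split=> //.
- apply/GammaP; split; first by apply: even_autM => //; apply: even_autV.
  move=> f hf /=; set g := gaut_inv l f.
  have hg : order_ge 1 g by apply: (@aut_order (l^-1)%g).
  have -> : f = l g by rewrite /g gaut_invK.
  pose g1 := component id 1%N g.
  have hg1 : homog id 1%N g1 by apply: homog_component.
  (* On the linear term g1, l gives exactly the leading form of p; the rest of g already has order
     2. *)
  have -> : p g - l g = p g1 - l g1 + (p (g - g1) - l (g - g1)).
    rewrite !raddfB /=; move: (p g) (l g) (p g1) (l g1) => a b c d.
    by rewrite [RHS]addrACA [c + _]addrC subrK opprK [- b + d]addrC addKr.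
  apply: order_geD.
    by rewrite (hl 1%N) //; apply: order_component; apply: aut_order;
      apply: homog_order.
  have hg2 : order_ge 2 (g - g1) by apply: order_component.
  by apply: order_geD; [|apply: order_geN]; apply: aut_order.
- exact/GLopP.
- by rewrite -mulgA mulgVK.
move=> i si; have px : p (x i) = x i.
  by rewrite (hp true) ?si ?component_id //; apply: homog_gen.
have lx : l (x i) = x i by rewrite (hl 1%N) ?px ?component_id.
have li : gaut_inv l (x i) = x i by rewrite -{1}lx gaut_funK.
split=> //=; last by rewrite li.
by rewrite -{1}px -[w _]/((w * p)%g (x i)) -sw.
Qed.

Lemma unipotent_factor s : unipotent s ->
  exists w g : aut, [/\ Omega w, Gamma g, s = (w * g)%g &
    forall i, s (x i) = x i -> w (x i) = x i /\ g (x i) = x i].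
Proof.
move=> hs; have [w [g [l [hw hg hl e0 hx]]]] := aut_factor s.
(* The linear factor is a product of automorphisms trivial on m/m^2, so it is itself trivial
   there. *)
have l1 : l = 1%g.
  apply: graded_unipotent_eq1; first exact/GLopP.
  have [_ ug] := (GammaP g).1 hg.
  have -> : l = (g^-1 * (w^-1 * s))%g by rewrite e0 !mulgA mulgVK mulVg mul1g.
  apply: unipotentM; first exact: unipotentV.
  by apply: unipotentM => //; apply: unipotentV; apply: Omega_unipotent.
exists w, g; split=> // [|i /hx[]] //.
by rewrite e0 l1 mulg1.
Qed.

End Automorphism.
From mathcomp Require Import classical_sets.

Local Open Scope classical_set_scope.
Local Open Scope ring_scope.

(** * The stabilizer of x_1 *)

Section Subgroups.
Variable G : groupType.
Implicit Types H L S : set G.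
Local Open Scope group_scope.

Lemma is_subgroupI H L : is_subgroup H -> is_subgroup L ->
  is_subgroup (H `&` L).
Proof.
move=> [h1 hM hV] [l1 lM lV]; split=> // [x y [hx lx] [hy ly]|x [hx lx]].
  by split; [apply: hM|apply: lM].
by split; [apply: hV|apply: lV].
Qed.

Lemma is_semidirectP H L S : is_subgroup S -> is_subgroup H -> is_subgroup L ->
  H `<=` S -> (forall x y, H x -> S y -> H (y * x * y^-1)) ->
  (forall x, H x -> L x -> x = 1) -> setmul H L = S -> is_semidirect H L S.
Proof.
move=> sS sH sL HS nH HL e; split=> //; apply/seteqP; split=> [x []|x ->].
  exact: HL.
by have [h1 _ _] := sH; have [l1 _ _] := sL.
Qed.

End Subgroups.

Section Stabilizer.
Variables (K : comPzRingType) (n : nat).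
Local Notation aut := (grassmann_aut K n).

Lemma Stab_is_subgroup (f : grassmann K n) : is_subgroup (Stab f : set aut).
Proof.
split=> [//|s t|s]; rewrite /Stab /= => hs; first by move=> ->.
by rewrite -{1}hs gaut_funK.
Qed.

End Stabilizer.

Theorem lemma4p4 (K : comPzRingType) (hred : reduced K) (hhalf : has_half K)
    (n : nat) (hn : (1 < n)%N) :
  let i1 : 'I_n := Ordinal (ltnW hn) in
  let x1 : grassmann K n := grassmann_gen K i1 in
  let Omega_x1 := @Omega K n `&` Stab x1 in
  let Gamma_x1 := @Gamma K n `&` Stab x1 in
  let GLop_x1 := @GLop K n `&` Stab x1 in
  [/\ Omega_x1 = [set s | exists2 a, (principal_ideal x1 `&` @odd_part K n) a &
                            is_omega (1 + a) s],
      Gamma_x1 = [set s | exists2 b,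
                            b i1 = 0 /\ (forall i, i != i1 -> odd_ge3 (b i)) &
                            is_gamma b s],
      GLop_x1 = [set s | exists2 A, GL A & is_sigma A s /\ s x1 = x1],
      Stab x1 = setmul (setmul Omega_x1 Gamma_x1) GLop_x1 &
      is_semidirect Omega_x1 Gamma_x1 (setmul Omega_x1 Gamma_x1) /\
      is_semidirect (setmul Omega_x1 Gamma_x1) GLop_x1 (Stab x1)].
Proof.
move=> i1 x1 Omega_x1 Gamma_x1 GLop_x1.
have x1_odd : homog odd true x1 by apply: homog_gen.
have sStab := Stab_is_subgroup x1; have [_ StabM StabV] := sStab.
have OmegaPr (s : grassmann_aut K n) := OmegaP hhalf s;
  have GammaPr (s : grassmann_aut K n) := GammaP hred s.
have GLopPr (s : grassmann_aut K n) := GLopP hred s.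
have sOmega : is_subgroup Omega_x1.
  apply: is_subgroupI => //; split; first exact: Omega1.
    exact: OmegaM.
  exact: OmegaV.
have sGamma : is_subgroup Gamma_x1.
  apply: is_subgroupI => //; split=> [|s t /GammaPr[es us] /GammaPr[et ut]|].
  - by apply/GammaPr; split=> // f _ S _; rewrite subrr ffunE.
  - by apply/GammaPr; split; [apply: even_autM|apply: unipotentM].
  - by move=> s /GammaPr[es us]; apply/GammaPr; split;
      [apply: even_autV|apply: unipotentV].
have sGLop : is_subgroup GLop_x1.
  apply: is_subgroupI => //; split=> [|s t /GLopPr hs /GLopPr ht|s /GLopPr hs].
  - by apply/GLopPr => i; rewrite -(cards1 i); apply: homog_basis.
  - by apply/GLopPr; apply: graded_autM.
  - by apply/GLopPr; apply: graded_autV.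
(* This description makes both the subgroup property of the product and its normality in the
   stabilizer immediate. *)
have OG : setmul Omega_x1 Gamma_x1 = @unipotent K n `&` Stab x1.
  apply/seteqP; split=> [_ [w [hw sw] [g [hg sg] <-]]|s [us ss]].
    split; last exact: StabM.
    have [_ ug] := (GammaPr g).1 hg.
    by apply: unipotentM => //; apply: Omega_unipotent hw.
  have [w [g [hw hg e0 /(_ i1 ss)[wx gx]]]] := unipotent_factor hred hhalf us.
  by exists w => //; exists g.
have sOG : is_subgroup (setmul Omega_x1 Gamma_x1).
  rewrite OG; apply: is_subgroupI => //; split.
  - by move=> f _ S _; rewrite subrr ffunE.
  - by move=> s t; apply: unipotentM.
  - by move=> s; apply: unipotentV.
have eStab : Stab x1 = setmul (setmul Omega_x1 Gamma_x1) GLop_x1.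
  apply/seteqP; split=> [s ss|_ [u + [l [_ sl] <-]]]; last first.
    by rewrite OG => -[_ su]; apply: StabM.
  have [w [g [l [hw hg hl e0 /(_ i1 ss)[wx gx lx]]]]] :=
    aut_factor hred hhalf s.
  exists (w * g)%g; last by exists l.
  by exists w => //; exists g.
split=> //.
- apply/seteqP; split=> [s [/OmegaPr[a ha hs] ss]|s [a [[g _ ag] /odd_partP
    ha]]].
    have ax : a * x1 = 0.
      apply: (double_eq0 hhalf); apply: (addrI x1).
      by rewrite addr0 -(omega_odd hhalf ha hs x1_odd).
    have [g ag] := annihilator_gen ax.
    exists a; last exact/(is_omegaP hhalf _ ha).
    split; last exact/odd_partP.
    (* As a is odd, only the even part of g matters in a = g x_1, and even elements commute with
       x_1, which moves x_1 to the left. *)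
    exists (component odd false g) => //.
    rewrite -(even_comm x1 (@homog_component _ _ _ odd false g)).
    by rewrite -(component_mul_gen true) -ag component_id.
  move=> /(is_omegaP hhalf _ ha) hs; split; first by apply/OmegaPr; exists a.
  have ax : a * x1 = 0.
    by rewrite (odd_anticomm ha x1_odd) -ag mulrA grassmann_gen_sqr mul0r oppr0.
  by rewrite /Stab /= (omega_odd hhalf ha hs x1_odd) ax !addr0.
- apply/seteqP; split=> [s [[b hb hs] ss]|s [b [b1 hb] hs]].
    exists b => //; split=> //; apply: (addrI x1).
    by rewrite addr0 -[RHS]ss; apply/esym; apply: hs.
  split; last by rewrite /Stab /= hs b1 addr0.
  exists b => // i; have [->|] := eqVneq i i1; last exact: hb.
  rewrite b1; split; first by apply/odd_partP; apply: homog0.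
  by apply/maxideal_pow3P => S _; rewrite ffunE.
- by apply/seteqP; split=> [s [[A hA hs] ss]|s [A hA [hs ss]]];
    [exists A|split=> //; exists A].
split; apply: is_semidirectP => //.
- move=> w hw; exists w => //; exists 1%g; last by rewrite mulg1.
  by case: sGamma.
- move=> w _ [hw sw] [v [hv sv] [g [hg sg] <-]].
  have [eg _] := (GammaPr g).1 hg; split; last first.
    have sy := StabM _ _ sv sg.
    exact: (StabM _ _ (StabM _ _ sy sw) (StabV _ sy)).
  (* Conjugation by g preserves Omega because g preserves parity; conjugation by v then takes place
     inside the group Omega. *)
  have -> : (v * g * w * (v * g)^-1 = v * (g * w * g^-1) * v^-1)%g.
    by rewrite invgM !mulgA.
  have hgw := OmegaJ hhalf eg hw.
  by apply: (OmegaM hhalf); [apply: (OmegaM hhalf)|apply: (OmegaV hhalf)].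
- move=> s [hs _] [/GammaPr[es _] _].
  exact: Omega_even_eq1 hs es.
- by rewrite OG => s [].
- rewrite OG => s t [us ss] st; split; first exact: unipotentJ.
  exact: (StabM _ _ (StabM _ _ st ss) (StabV _ st)).
- rewrite OG => s [us _] [/GLopPr gs _]; exact: graded_unipotent_eq1 gs us.
Qed.
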